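(* Let $\mathbf u=\mathcal G(u_0,v_0,\boldsymbol\Upsilon)$, where $u_0,v_0$ are finite non-empty binary words and $\boldsymbol\Upsilon=(\Upsilon_k)_{k\ge0}$ is a periodic $(0,1)$-sequence, and let $(u_k)_k,(v_k)_k$ be the sequences of words defining $\mathbf u$. Then $$\sigma(\mathbf u)=\mathcal G\bigl(\sigma(u_2)^*,\sigma(v_2)^*,(\Upsilon_{2+k})_{k\ge0}\bigr).$$
   Context: Binary words and sequences take values in $\{0,1\}$. Juxtaposition of words is concatenation. For finite words $u_0,v_0$ and a periodic $(0,1)$-sequence $\boldsymbol\Upsilon=(\Upsilon_k)_{k\ge0}$, define for $k\ge0$: if $\Upsilon_k=0$, $u_{k+1}=u_ku_k$ and $v_{k+1}=v_kv_k$; if $\Upsilon_k=1$, $u_{k+1}=u_kv_k$ and $v_{k+1}=v_ku_k$. $\mathcal G(u_0,v_0,\boldsymbol\Upsilon)$ denotes the infinite sequence $\lim_k u_k$. The operator $\sigma$ maps a binary sequence $(x_i)_{i\ge0}$ to $\left(\sum_{j=0}^{i-1}x_j\bmod 2\right)_{i\ge0}$. For a finite binary word $a=x_0\cdots x_{L-1}$ of length $L$, $\sigma(a)$ is the word of length $L+1$ whose $i$-th letter ($0\le i\le L$) is $\sum_{j=0}^{i-1}x_j\bmod2$. For a non-empty word $a$, $a^*$ denotes the word obtained from $a$ by deleting its last letter; so $\sigma(a)^*$ has the same length as $a$. *)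

(* Defs.v *)
From mathcomp Require Import all_boot.

Set Implicit Arguments.
Unset Strict Implicit.
Unset Printing Implicit Defensive.

(* The letters 0 and 1 are [false] and [true]; a finite word is a [seq bool],
   an infinite sequence a function [nat -> bool]. *)

Definition periodic (Y : nat -> bool) : Prop :=
  exists2 p : nat, 0 < p & forall k, Y (k + p) = Y k.

Fixpoint words (u0 v0 : seq bool) (Y : nat -> bool) (k : nat) :
    seq bool * seq bool :=
  if k is k'.+1 then
    let: (u, v) := words u0 v0 Y k' in
    if Y k' then (u ++ v, v ++ u) else (u ++ u, v ++ v)
  else (u0, v0).

Definition uword u0 v0 Y k := (words u0 v0 Y k).1.
Definition vword u0 v0 Y k := (words u0 v0 Y k).2.

Definition word_limit (w : nat -> seq bool) (x : nat -> bool) : Prop :=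
  forall i, exists K, forall k, K <= k ->
    i < size (w k) /\ nth false (w k) i = x i.

(* The limit of the words u_k: since u_k is a prefix of u_(k+1) and, for
   non-empty u_0 and v_0, u_i has length at least 2^i > i, the i-th letter of
   the limit can be read off u_i; see [Gseq_limit] and [word_limit_unique]. *)
Definition Gseq (u0 v0 : seq bool) (Y : nat -> bool) : nat -> bool :=
  fun i => nth false (uword u0 v0 Y i) i.

(* [odd] takes the sum of the letters, as natural numbers, modulo 2. *)
Definition sigma (x : nat -> bool) : nat -> bool :=
  fun i => odd (\sum_(j < i) x j).

Definition sigma_word (a : seq bool) : seq bool :=
  mkseq (fun i => odd (\sum_(j < i) nth false a j)) (size a).+1.

Definition del_last (a : seq bool) : seq bool := take (size a).-1 a.

Lemma words_size u0 v0 Y k : u0 != [::] -> v0 != [::] ->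
  k < size (uword u0 v0 Y k) /\ k < size (vword u0 v0 Y k).
Proof.
rewrite /uword /vword -!size_eq0 -!lt0n => u0_gt0 v0_gt0.
elim: k => [|k] //=; case: (words _ _ _ k) => u v /= [ltu ltv].
have lt_cat (a b : seq bool) :
    k < size a -> k < size b -> k.+1 < size (a ++ b).
  move=> lta ltb; rewrite size_cat -[k.+2]addn1.
  exact: leq_add lta (leq_ltn_trans (leq0n k) ltb).
by case: (Y k); split; apply: lt_cat.
Qed.

Lemma uword_prefix u0 v0 Y m n :
  m <= n -> prefix (uword u0 v0 Y m) (uword u0 v0 Y n).
Proof.
move=> /subnKC <-; elim: (n - m) => [|d IHd]; first by rewrite addn0 prefix_refl.
apply: prefix_trans IHd _; rewrite addnS /uword /=.
by case: (words _ _ _ _) => u v; case: (Y _); rewrite /= prefix_prefix.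
Qed.

Lemma Gseq_limit u0 v0 Y : u0 != [::] -> v0 != [::] ->
  word_limit (uword u0 v0 Y) (Gseq u0 v0 Y).
Proof.
move=> u0n v0n i; exists i => k leik.
have [lti _] := words_size Y i u0n v0n.
have /prefixP[s Es] := uword_prefix u0 v0 Y leik.
by rewrite Es size_cat nth_cat lti ltn_addr.
Qed.

Lemma word_limit_unique w x y : word_limit w x -> word_limit w y -> x =1 y.
Proof.
move=> wx wy i; have [K1 H1] := wx i; have [K2 H2] := wy i.
have [_ <-] := H1 _ (leq_maxl K1 K2).
by have [_ <-] := H2 _ (leq_maxr K1 K2).
Qed.

(* Main.v *)
(* For [k >= 2] the words [u_k] and [v_k] have an even number of letters 1, so
   partial sums mod 2 restart from 0 after each of them: [a |-> sigma(a)^*] is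
   multiplicative on these words and commutes with the recursion for
   [(u_k, v_k)]. *)
Require Import Defs.
From mathcomp Require Import all_boot.

Lemma sum_nth_take (a : seq bool) i :
  \sum_(j < i) nth false a j = count id (take i a).
Proof.
elim: a i => [|x a IHa] [|i]; rewrite ?big_ord0 //=.
  (* Past the end of the word the default letter [false] contributes 0. *)
  by rewrite big1 // => j _; rewrite nth_nil.
by rewrite big_ord_recl /= -IHa.
Qed.

Lemma size_del_last_sigma (a : seq bool) :
  size (del_last (sigma_word a)) = size a.
Proof. by rewrite /del_last size_take size_mkseq ltnSn. Qed.

Lemma nth_del_last_sigma (a : seq bool) i : i < size a ->
  nth false (del_last (sigma_word a)) i = odd (count id (take i a)).
Proof.
move=> lti; rewrite /del_last size_mkseq nth_take // nth_mkseq 1?ltnW //.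
by rewrite sum_nth_take.
Qed.

(** Beyond [a], a partial sum is the total of [a], which vanishes mod 2, plus a partial sum of
    [b]. *)
Lemma del_last_sigma_cat (a b : seq bool) : ~~ odd (count id a) ->
  del_last (sigma_word (a ++ b)) =
  del_last (sigma_word a) ++ del_last (sigma_word b).
Proof.
move=> even_a; apply: (@eq_from_nth _ false) => [|i].
  by rewrite size_cat !size_del_last_sigma size_cat.
rewrite size_del_last_sigma => lti; rewrite nth_cat size_del_last_sigma.
rewrite nth_del_last_sigma // take_cat; case: ltnP => [ltia | leai].
  by rewrite nth_del_last_sigma.
rewrite nth_del_last_sigma; last by rewrite ltn_subLR // -size_cat.
by rewrite count_cat oddD (negbTE even_a).
Qed.

(** One step of either kind gives two words of equal parity; the next step concatenates two words of
    equal parity, so both results are even. This is why the shift is by 2. *)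
Lemma even_words u0 v0 Y k :
  ~~ odd (count id (uword u0 v0 Y k.+2)) /\
  ~~ odd (count id (vword u0 v0 Y k.+2)).
Proof.
rewrite /uword /vword /=; case: (words _ _ _ k) => u v.
case: (Y k); case: (Y k.+1); rewrite /= !count_cat !oddD;
  by case: (odd (count id u)); case: (odd (count id v)).
Qed.

Lemma words_del_last_sigma u0 v0 Y k :
  words (del_last (sigma_word (uword u0 v0 Y 2)))
        (del_last (sigma_word (vword u0 v0 Y 2))) (fun k => Y (2 + k)) k =
  (del_last (sigma_word (uword u0 v0 Y k.+2)),
   del_last (sigma_word (vword u0 v0 Y k.+2))).
Proof.
elim: k => [//|k IHk]; rewrite [LHS]/= IHk add2n.
have [] := even_words u0 v0 Y k; rewrite /uword /vword.
rewrite [words u0 v0 Y k.+3]/= -/(words u0 v0 Y k.+2).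
case: (words u0 v0 Y k.+2) => u v /= even_u even_v.
by case: (Y k.+2); rewrite /= !del_last_sigma_cat.
Qed.

Theorem proposition3p7 (u0 v0 : seq bool) (Y : nat -> bool)
    (hu0 : u0 != [::]) (hv0 : v0 != [::]) (hY : periodic Y) :
  sigma (Gseq u0 v0 Y) =1
  Gseq (del_last (sigma_word (uword u0 v0 Y 2)))
       (del_last (sigma_word (vword u0 v0 Y 2)))
       (fun k => Y (2 + k)).
Proof.
(* Step [i] of the shifted recursion corresponds to [u_(i+2)], so the right-hand letter is a partial
   sum over that word. *)
move=> i; rewrite /Gseq {2}/uword words_del_last_sigma /=.
have [lt_size _] := words_size Y i.+2 hu0 hv0.
rewrite nth_del_last_sigma; last by rewrite (ltn_trans _ lt_size) // leqnSn.
rewrite -sum_nth_take /sigma; congr odd; apply: eq_bigr => j _.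
(* On the left, letter [j] is read off [u_j], a prefix of [u_(i+2)] long enough to contain position
   [j]. *)
have [ltj _] := words_size Y j hu0 hv0.
have lej : j <= i.+2 by rewrite ltnW // (ltn_trans (ltn_ord j)) // ltnW.
have /prefixP[s ->] := uword_prefix u0 v0 Y lej.
by rewrite nth_cat ltj.
Qed.
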